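(* There is no competitive online algorithm for the dual problem of the $k$-taxi linear program described below, even for $k=1$.
   Context: Setting: a rooted tree $T=(V,E)$ with root $r$ and all edges of unit length; $p(u)$ denotes the parent of $u\neq r$ and $V_u$ the vertex set of the subtree rooted at $u$. There are $k$ servers with a given initial configuration. A $k$-taxi request sequence is written over times $1,\dots,2T$: at odd times $t\in T_s=\{1,3,\dots,2T-1\}$ there is a simple request at a vertex $s_t$ (a server must be brought to $s_t$); at even times $t\in T_r=\{2,4,\dots,2T\}$ there is a relocation request moving a server from $s_t=s_{t-1}$ to a vertex $d_t$ at no cost. The servers of the algorithm DoubleCoverage (DC) are numbered $i=1,\dots,k$ and $v_{it}$ is the location of DC's server $i$ after time $t$ ($v_{i0}$ = initial location). DC on a tree: to bring a server to $s$, all unobstructed servers (those with no other server on their path to $s$; among co-located servers only one counts) move toward $s$ at equal speed until one reaches $s$, servers becoming obstructed stop; at a relocation request DC relocates a server from $s_t$ to $d_t$. The dual LP has variables $A_{ut}$ (altitudes) for $u\in V$, $t=0,1,\dots,2T$, constraints $A_{ut}-A_{p(u)t}\in[-1,1]$ for all $u\neq r$ and all $t$ with $t+1\in T_s$, and $A_{ut}-A_{u,t-1}\ge0$ for all $u\in V$, $t\in\{1,\dots,2T\}$, and objective to maximize $$\sum_{t\in T_s}\Big[(A_{s_tt}-A_{s_t,t-1})-\sum_{i=1}^k(A_{v_{it}t}-A_{v_{i,t-1},t-1})\Big]-\sum_{t\in T_r}\sum_{i=1}^k(A_{v_{it}t}-A_{v_{it},t-1}).$$ An online algorithm for this dual fixes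 all values $A_{u0}$ before any request and, at each time $t$, after requests $1,\dots,t$ are revealed, irrevocably fixes $A_{ut}$ for all $u\in V$, producing a feasible solution. It is competitive if there are constants $c>0$ and $a$ such that on every instance its objective value is at least $\frac1c\cdot\mathrm{OPT}-a$, where OPT is the optimal value of the dual LP for that instance. *)

(* Defs.v *)
From HB Require Import structures.
From mathcomp Require Import all_boot all_order all_algebra.
From mathcomp Require Import boolp classical_sets reals ereal.

Set Implicit Arguments.
Unset Strict Implicit.
Unset Printing Implicit Defensive.

Import Order.TTheory GRing.Theory Num.Theory.
Local Open Scope ring_scope.

(* The edges are the pairs {u, parent u} with u != tree_root, all of unit length.
   The value parent tree_root = tree_root is a dummy that makes parent total. *)
Record rootedTree := RootedTree {
  vertex :> finType;
  tree_root : vertex;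
  parent : vertex -> vertex;
  parent_root : parent tree_root = tree_root;
  parent_reach : forall u, exists n, iter n parent u = tree_root
}.

Arguments tree_root {r}.

Section Tree.
Variable G : rootedTree.

(* V_u, with u itself included *)
Definition subtree (u : G) : {set G} := [set v | fconnect (@parent G) v u].

(* The neighbour of v on the path from v to s (v itself if v = s): the child of
   v whose subtree contains s if s lies below v, the parent of v otherwise. *)
Definition next_hop (s v : G) : G :=
  if v == s then v
  else if s \in subtree v then
    odflt v [pick c | [&& c != tree_root, parent c == v & s \in subtree c]]
  else parent v.

(* Distances are at most #|G| - 1, so #|G| hops suffice; s is absorbing. *)
Definition tree_path (s v : G) : {set G} :=
  [set w in traject (next_hop s) v #|G|.+1].

End Tree.

Section KTaxi.
Variables (G : rootedTree) (k : nat).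

Definition configuration := {ffun 'I_k -> G}.

(* An instance on (G, k, initial configuration) with horizon 2T is the list of
   the 2T requested vertices: the entry of an odd time t is s_t, that of an even
   time t is d_t, and s_t = s_{t-1} for t even.  Times start at 1. *)
Definition request (rho : seq G) (t : nat) : G := nth tree_root rho t.-1.

(* Of several co-located servers, only the one of least index may move. *)
Definition unobstructed (s : G) (v : configuration) (i : 'I_k) : bool :=
  [forall j : 'I_k, (j != i) && (v j \in tree_path s (v i)) ==>
     (v j == v i) && (i < j)%N].

(* One unit of time of the continuous motion.  Since edges have unit length and
   servers start at vertices, servers meet, become obstructed or reach s only at
   integer times, when all of them are at vertices. *)
Definition dc_move (s : G) (v : configuration) : configuration :=
  if [exists i, v i == s] then v
  else [ffun i => if unobstructed s v i then next_hop s (v i) else v i].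

(* A closest server gets one edge closer at each move until s is reached. *)
Definition dc_serve (s : G) (v : configuration) : configuration :=
  iter #|G| (dc_move s) v.

Definition dc_relocate (s d : G) (v : configuration) : configuration :=
  if [pick i | v i == s] is Some i0 then [ffun i => if i == i0 then d else v i]
  else v.

(* dc v0 rho t i is v_{it} *)
Fixpoint dc (v0 : configuration) (rho : seq G) (t : nat) : configuration :=
  if t isn't t'.+1 then v0
  else if odd t then dc_serve (request rho t) (dc v0 rho t')
  else dc_relocate (request rho t') (request rho t) (dc v0 rho t').

Variable R : realType.

(* Altitudes A u t; only the times t <= 2T matter. *)
Definition dual_feasible (T : nat) (A : G -> nat -> R) : Prop :=
  (forall (u : G) (t : nat), u != tree_root -> (t < T.*2)%N -> odd t.+1 ->
     -1 <= A u t - A (parent u) t <= 1) /\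
  (forall (u : G) (t : nat), (1 <= t <= T.*2)%N -> 0 <= A u t - A u t.-1).

Definition dual_objective (v0 : configuration) (T : nat) (rho : seq G)
    (A : G -> nat -> R) : R :=
  let v t i := dc v0 rho t i in
  let s t := request rho t in
  \sum_(1 <= t < (T.*2).+1 | odd t)
     ((A (s t) t - A (s t) t.-1)
      - \sum_(i < k) (A (v t i) t - A (v t.-1 i) t.-1))
  - \sum_(1 <= t < (T.*2).+1 | ~~ odd t)
     \sum_(i < k) (A (v t i) t - A (v t i) t.-1).

Definition dual_opt (v0 : configuration) (T : nat) (rho : seq G) : \bar R :=
  ereal_sup [set (dual_objective v0 T rho A)%:E | A in dual_feasible T].

End KTaxi.

Section Online.
Variables (k : nat) (R : realType).

(* The tree and the initial configuration are known in advance.  The value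
   alg G v0 w u is A_{ut} for t = size w, where w lists requests 1, ..., t;
   the horizon is not an input. *)
Definition online_algorithm :=
  forall G : rootedTree, configuration G k -> seq G -> G -> R.

Definition altitudes (alg : online_algorithm) (G : rootedTree)
    (v0 : configuration G k) (rho : seq G) : G -> nat -> R :=
  fun u t => alg G v0 (take t rho) u.

Definition produces_feasible (alg : online_algorithm) : Prop :=
  forall (G : rootedTree) (v0 : configuration G k) (T : nat) (rho : seq G),
    size rho = T.*2 -> dual_feasible T (altitudes alg v0 rho).

Definition competitive (alg : online_algorithm) : Prop :=
  exists c a : R, 0 < c /\
    forall (G : rootedTree) (v0 : configuration G k) (T : nat) (rho : seq G),
      size rho = T.*2 ->
      (c^-1%:E * dual_opt R v0 T rho - a%:E
         <= (dual_objective v0 T rho (altitudes alg v0 rho))%:E)%E.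

End Online.

(* Main.v *)
Require Import Defs.
From mathcomp Require Import all_boot all_order all_algebra.
From mathcomp Require Import boolp classical_sets reals ereal.
From mathcomp Require Import zify lra.

(* Take a path of 2M+2 vertices with k-1 servers standing at its ends and the
   remaining server i0 on the middle edge.  The adversary keeps the other servers
   behind i0, so that DC moves only i0 when the far vertex of the edge is
   requested.  After that request the adversary looks at the online altitudes and
   relocates i0 to the endpoint d of the edge with the smaller one, moves the
   other servers behind d by requests at their own positions (on which DC does not
   move), and repeats.  With s the other endpoint, the online objective plus
   A_d - A_s never increases, so the objective stays bounded.  An offline solution
   knows d: it raises a tent over the middle edge by one per round, higher at d
   than at s, and earns one per round, at no cost as long as the tent has not
   reached the ends of the path. *)

Set Implicit Arguments.
Unset Strict Implicit.
Unset Printing Implicit Defensive.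

Import Order.TTheory GRing.Theory Num.Theory.

(** * Extension of a request sequence by one round *)

Section PrefixDependence.
Variables (G : rootedTree) (k : nat) (R : realType).
Variable v0 : configuration G k.
Implicit Types (rho : seq G) (A B : G -> nat -> R).

Lemma request_cat rho rho' t :
  (0 < t <= size rho)%N -> request (rho ++ rho') t = request rho t.
Proof. by move=> t_range; rewrite /request nth_cat ifT //; lia. Qed.

Lemma dc_cat rho rho' t :
  (t <= size rho)%N -> dc v0 (rho ++ rho') t = dc v0 rho t.
Proof.
elim: t => [//|t IHt] lt_t /=; rewrite IHt ?(ltnW lt_t) //.
rewrite (request_cat rho' (t := t.+1)) //.
case: t {IHt} lt_t => [//|t] lt_t.
by rewrite (request_cat rho' (t := t.+1)) ?(ltnW lt_t).
Qed.

Lemma dc_cat2 rho s d T : size rho = T.*2 ->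
  dc v0 (rho ++ [:: s; d]) T.*2.+1 = dc_serve s (dc v0 rho T.*2) /\
  dc v0 (rho ++ [:: s; d]) T.*2.+2 =
    dc_relocate s d (dc_serve s (dc v0 rho T.*2)).
Proof.
move=> size_rho.
have Es : request (rho ++ [:: s; d]) T.*2.+1 = s.
  by rewrite /request nth_cat size_rho ltnn subnn.
have Ed : request (rho ++ [:: s; d]) T.*2.+2 = d.
  by rewrite /request nth_cat size_rho ltnNge leqnSn subSnn.
have E1 : dc v0 (rho ++ [:: s; d]) T.*2.+1 = dc_serve s (dc v0 rho T.*2).
  by rewrite /= odd_double /= Es dc_cat ?size_rho.
split=> //.
have dcS rho' t : dc v0 rho' t.+1 = if odd t.+1
    then dc_serve (request rho' t.+1) (dc v0 rho' t)
    else dc_relocate (request rho' t) (request rho' t.+1) (dc v0 rho' t) by [].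
rewrite dcS [odd _]/= odd_double.
by rewrite E1 Es Ed.
Qed.

Local Open Scope ring_scope.

(** The contribution of an odd time to the dual objective; [relocate_loss] is, up to sign, that of
    an even time. *)
Definition serve_gain (s : G) (v v' : configuration G k) (A A' : G -> R) : R :=
  (A' s - A s) - \sum_(i < k) (A' (v' i) - A (v i)).

Definition relocate_loss (v : configuration G k) (A A' : G -> R) : R :=
  \sum_(i < k) (A' (v i) - A (v i)).

(** The summand of time t reads only requests and altitudes up to t. With [rho' = [::]] this swaps
    altitudes that agree up to the horizon. *)
Lemma dual_objective_prefix rho rho' T A B : (T.*2 <= size rho)%N ->
  (forall u t, (t <= T.*2)%N -> A u t = B u t) ->
  dual_objective v0 T (rho ++ rho') A = dual_objective v0 T rho B.
Proof.
move=> size_rho eqAB; rewrite /dual_objective.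
rewrite !(big_mkcond (fun t => odd t)) !(big_mkcond (fun t => ~~ odd t)).
congr (_ - _); apply: eq_big_nat => t t_range; case: ifP => // _.
  rewrite request_cat; last by lia.
  congr (_ - _ - _); try by rewrite eqAB //; lia.
  by apply: eq_bigr => i _; rewrite !dc_cat ?eqAB //; lia.
by apply: eq_bigr => i _; rewrite !dc_cat ?eqAB //; lia.
Qed.

Lemma dual_objectiveS rho s d T A : size rho = T.*2 ->
  let v := dc v0 rho T.*2 in
  let v' := dc_serve s v in
  dual_objective v0 T.+1 (rho ++ [:: s; d]) A =
  dual_objective v0 T rho A
  + serve_gain s v v' (A^~ T.*2) (A^~ T.*2.+1)
  - relocate_loss (dc_relocate s d v') (A^~ T.*2.+1) (A^~ T.*2.+2).
Proof.
move=> size_rho v v'.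
have [E1 E2] := dc_cat2 s d size_rho.
have Es : request (rho ++ [:: s; d]) T.*2.+1 = s.
  by rewrite /request nth_cat size_rho ltnn subnn.
rewrite -(@dual_objective_prefix rho [:: s; d] T A A) ?size_rho //.
rewrite {}/v' -{}E2 -{}E1 {}/v -(dc_cat [:: s; d] (t := T.*2)) ?size_rho //.
rewrite /dual_objective doubleS.
move: (dc v0 _) (request _) Es => v r Es.
rewrite !(big_mkcond (fun t => odd t)) !(big_mkcond (fun t => ~~ odd t)) /=.
rewrite !(big_nat_recr T.*2.+2) //= !(big_nat_recr T.*2.+1) //=.
rewrite odd_double /= Es /serve_gain /relocate_loss.
by rewrite !addr0 opprD addrACA !addrA.
Qed.

End PrefixDependence.

(** * Moves of DC *)

Section DoubleCoverage.
Variables (G : rootedTree) (k : nat).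
Implicit Types (v : configuration G k) (s x : G).

Lemma next_hop_id s : next_hop s s = s.
Proof. by rewrite /next_hop eqxx. Qed.

Lemma tree_pathP s x w :
  reflect (exists2 j, (j <= #|G|)%N & w = iter j (next_hop s) x)
          (w \in tree_path s x).
Proof. by rewrite inE; apply: (iffP trajectP) => -[j]; exists j. Qed.

Lemma tree_path_adjacent s x w :
  next_hop s x = s -> w \in tree_path s x -> (w == x) || (w == s).
Proof.
move=> adj /tree_pathP [j _ ->]; case: j => [|j]; first by rewrite eqxx.
rewrite iterSr adj; suff -> : iter j (next_hop s) s = s by rewrite eqxx orbT.
by elim: j => //= j ->; rewrite next_hop_id.
Qed.

Lemma dc_serve_id s v i : v i = s -> dc_serve s v = v.
Proof.
move=> vi; rewrite /dc_serve; elim: #|G| => //= m ->.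
by rewrite /dc_move ifT //; apply/existsP; exists i; rewrite vi.
Qed.

(* The condition on the other servers says that server i0 obstructs them all. *)
Lemma dc_serve_adjacent s v i0 :
  v i0 != s -> next_hop s (v i0) = s ->
  (forall i, i != i0 ->
     [/\ v i != s, v i != v i0 & v i0 \in tree_path s (v i)]) ->
  dc_serve s v = [ffun i => if i == i0 then s else v i].
Proof.
move=> v0s adj others.
have far : ~~ [exists i, v i == s].
  apply/existsPn => i; have [->//|/others [//]] := eqVneq i i0.
have move1 : dc_move s v = [ffun i => if i == i0 then s else v i].
  rewrite /dc_move (negbTE far); apply/ffunP => i; rewrite !ffunE.
  have [->|i_neq] := eqVneq i i0.
    rewrite ifT //; apply/forallP => j; apply/implyP => /andP [/others [vjs vj0 _]].
    by move/(tree_path_adjacent adj); rewrite (negbTE vjs) (negbTE vj0).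
  rewrite ifF //; have [_ vi0 on_path] := others _ i_neq.
  apply/negP => /forallP /(_ i0).
  by rewrite eq_sym i_neq on_path /= eq_sym (negbTE vi0).
have card_gt0 : (0 < #|G|)%N by apply/card_gt0P; exists s.
(* The first of the [#|G|] moves reaches s, and the remaining ones change nothing. *)
rewrite /dc_serve -(prednK card_gt0) iterSr move1.
set v' := finfun _; have v's : v' i0 = s by rewrite ffunE eqxx.
elim: #|G|.-1 => //= m ->.
by rewrite /dc_move ifT //; apply/existsP; exists i0; rewrite v's.
Qed.

Lemma dc_relocate_unique s d v i0 :
  v i0 = s -> (forall i, i != i0 -> v i != s) ->
  dc_relocate s d v = [ffun i => if i == i0 then d else v i].
Proof.
move=> vi0 others; rewrite /dc_relocate; case: pickP => [i vi|/(_ i0)].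
  by have [->//|/others] := eqVneq i i0; rewrite vi.
by rewrite vi0 eqxx.
Qed.

Lemma dc_relocate_some s d v i : v i = s ->
  exists2 i1, v i1 = s &
    dc_relocate s d v = [ffun i => if i == i1 then d else v i].
Proof.
move=> vi; rewrite /dc_relocate; case: pickP => [i1 /eqP vi1|/(_ i)].
  by exists i1.
by rewrite vi eqxx.
Qed.

End DoubleCoverage.

(** * Paths as rooted trees *)

Section Line.
Variable n : nat.

(** Truncation at 0 makes 0 its own dummy parent, hence the root. *)
Definition line_parent (u : 'I_n.+1) : 'I_n.+1 := inord u.-1.

Lemma val_line_parent u : line_parent u = u.-1 :> nat.
Proof. by rewrite inordK //; have := ltn_ord u; lia. Qed.

Lemma val_iter_line_parent j u : iter j line_parent u = (u - j)%N :> nat.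
Proof. by elim: j => [|j IHj]; rewrite ?subn0 // iterS val_line_parent IHj; lia. Qed.

Lemma line_parent_root : line_parent ord0 = ord0.
Proof. by apply: ord_inj; rewrite val_line_parent. Qed.

Lemma line_parent_reach u : exists j, iter j line_parent u = ord0.
Proof. by exists u; apply: ord_inj; rewrite val_iter_line_parent subnn. Qed.

Definition line : rootedTree := RootedTree line_parent_root line_parent_reach.
Implicit Types u s : 'I_n.+1.

Lemma subtree_line u s : (s \in subtree (u : line)) = (u <= s)%N.
Proof.
rewrite inE; apply/idP/idP => [/iter_findex <-|le_us].
  by rewrite val_iter_line_parent leq_subr.
have -> : u = iter (s - u)%N line_parent s.
  by apply: ord_inj; rewrite val_iter_line_parent subKn.
exact: fconnect_iter.
Qed.

Lemma next_hop_line_up u s : (u < s)%N ->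
  next_hop (s : line) u = u.+1 :> nat.
Proof.
move=> lt_us; have lt_un : (u.+1 < n.+1)%N by apply: leq_ltn_trans lt_us _.
rewrite /next_hop ifF; last by apply/eqP => eq_us; rewrite eq_us ltnn in lt_us.
rewrite subtree_line ltnW //.
(* Excluding the root matters at u = 0, where 0 itself satisfies the other two conditions. *)
case: pickP => [c /and3P [c_neq0 /eqP <- _]|/(_ (Ordinal lt_un : line))] /=.
  rewrite val_line_parent prednK // lt0n.
  by apply: contraNneq c_neq0 => c0; apply/eqP/ord_inj.
rewrite subtree_line /= lt_us andbT => /negbT/negP [].
by apply/eqP/ord_inj; rewrite val_line_parent.
Qed.

Lemma next_hop_line_down u s : (s < u)%N ->
  next_hop (s : line) u = u.-1 :> nat.
Proof.
move=> lt_su; rewrite /next_hop ifF; last first.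
  by apply/eqP => eq_us; rewrite eq_us ltnn in lt_su.
by rewrite subtree_line leqNgt lt_su /= val_line_parent.
Qed.

Lemma tree_path_line (x s w : 'I_n.+1) :
  (x <= w <= s)%N || (s <= w <= x)%N -> w \in tree_path (s : line) x.
Proof.
case/orP => between; apply/tree_pathP.
  exists (w - x)%N; first by rewrite card_ord; have := ltn_ord w; lia.
  have iterE j : (j <= s - x)%N -> iter j (next_hop (s : line)) x = (x + j)%N :> nat.
    elim: j => [|j IHj] le_j /=; first by rewrite addn0.
    by rewrite next_hop_line_up IHj; lia.
  by apply: ord_inj; rewrite /= iterE; lia.
exists (x - w)%N; first by rewrite card_ord; have := ltn_ord x; lia.
have iterE j : (j <= x - s)%N -> iter j (next_hop (s : line)) x = (x - j)%N :> nat.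
  elim: j => [|j IHj] le_j /=; first by rewrite subn0.
  by rewrite next_hop_line_down IHj; lia.
by apply: ord_inj; rewrite /= iterE; lia.
Qed.

End Line.

Local Open Scope ring_scope.

(** * Gains and losses within one round *)

Section Gains.
Variables (R : realType) (G : rootedTree) (k : nat).
Implicit Types (v : configuration G k) (g h : G -> R).

(** The new altitude of s cancels: the request gains it and server [i0], which ends at s, loses
    it. *)
Lemma serve_gain_move s v v' i0 g h :
  v' i0 = s -> (forall i, i != i0 -> v' i = v i) ->
  serve_gain s v v' g h =
  g (v i0) - g s - \sum_(i < k | i != i0) (h (v i) - g (v i)).
Proof.
move=> v'0 others; rewrite /serve_gain (bigD1 i0) //= v'0.
under eq_bigr => i i_neq do rewrite others //.
by rewrite opprD addrA; congr (_ - _); lra.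
Qed.

Lemma relocate_loss_ge v i g h : (forall u, g u <= h u) ->
  h (v i) - g (v i) <= relocate_loss v g h.
Proof.
move=> le_gh; rewrite /relocate_loss (bigD1 i) //= lerDl.
by apply: sumr_ge0 => j _; rewrite subr_ge0.
Qed.

(** Slopes are constrained at even times before the horizon, so the longer horizon adds only the
    slopes at 2T; [B] is subject to monotonicity alone. *)
Lemma feasible_extend T (A : G -> nat -> R) (B : G -> R) :
  dual_feasible T A ->
  (forall u, -1 <= A u T.*2 - A (parent u) T.*2 <= 1) ->
  (forall u, A u T.*2 <= B u) ->
  dual_feasible T.+1 (fun u t => if (t <= T.*2)%N then A u t else B u).
Proof.
move=> [lipA monoA] lipA_end leAB; split=> u t; rewrite doubleS.
  move=> u_neq t_lt odd_t; have le_t : (t <= T.*2)%N by lia.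
  rewrite le_t; move: le_t; rewrite leq_eqVlt => /predU1P [->//|t_lt'].
  exact: lipA.
move=> /andP [t_gt0 t_le]; have [le_t|lt_t] := leqP t T.*2.
  by rewrite ifT; [apply: monoA; rewrite t_gt0 | lia].
by case: ifP => [?|_]; rewrite ?subrr // (_ : t.-1 = T.*2) ?subr_ge0 //; lia.
Qed.

End Gains.

(** * The path, the gathered servers and the tents *)

Section Adversary.
Variables (R : realType) (k M : nat) (i0 : 'I_k).
Hypothesis M_gt0 : (0 < M)%N.

Let G := line M.*2.+1.

(** The middle edge joins M and M+1; [home b] is the end of the path on the side of [edge b]. *)
Definition edge (b : bool) : G := inord (M + b) : 'I_M.*2.+2.
Definition home (b : bool) : G := inord (b * M.*2.+1) : 'I_M.*2.+2.

Lemma val_edge b : edge b = (M + b)%N :> nat.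
Proof. by rewrite inordK //; case: b; lia. Qed.

Lemma val_home b : home b = (b * M.*2.+1)%N :> nat.
Proof. by rewrite inordK //; case: b; lia. Qed.

Lemma edge_neq b : edge b != edge (~~ b).
Proof. by apply/eqP => /(congr1 val); rewrite /= !val_edge; case: b; lia. Qed.

Lemma home_neq b : home b != home (~~ b).
Proof. by apply/eqP => /(congr1 val); rewrite /= !val_home; case: b; lia. Qed.

Lemma home_neq_edge b b' : home b != edge b'.
Proof.
by apply/eqP => /(congr1 val); rewrite /= val_edge val_home; case: b; case: b'; lia.
Qed.

Definition gathered b : configuration G k :=
  [ffun i => if i == i0 then edge b else home b].

(** Server [i0] stands between [home b] and [edge (~~ b)], so it obstructs all others. *)
Lemma serve_gathered b :
  dc_serve (edge (~~ b)) (gathered b) =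
  [ffun i => if i == i0 then edge (~~ b) else home b].
Proof.
have v0 : gathered b i0 = edge b by rewrite ffunE eqxx.
have vi i : i != i0 -> gathered b i = home b by rewrite ffunE => /negbTE ->.
rewrite (@dc_serve_adjacent _ _ _ _ i0) ?v0 ?edge_neq //.
- by apply/ffunP => i; rewrite !ffunE; case: eqP.
- apply: ord_inj; case: b {v0 vi}.
    by rewrite next_hop_line_down val_edge /= val_edge; lia.
  by rewrite next_hop_line_up val_edge /= val_edge; lia.
move=> i /vi ->; rewrite !home_neq_edge; split=> //.
apply: tree_path_line; rewrite !val_edge val_home; case: b {v0 vi}; lia.
Qed.

(* The edge vertices get j+1 (at [edge b]) and j (at the other one); truncated
   subtraction cuts the slopes off at 0. *)
Definition tent_nat (j : nat) (b : bool) (u : nat) : nat :=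
  if (u <= M)%N then (j + ~~ b - (M - u))%N else (j + b - (u - M.+1))%N.

Definition tent j b (u : G) : R := (tent_nat j b (u : 'I_M.*2.+2))%:R.

Lemma tent_edge j b b' : tent j b (edge b') = (j + (b' == b))%:R.
Proof.
rewrite /tent val_edge /tent_nat; congr (_ *+ _).
by case: b; case: b' => /=; do ?case: ifP; lia.
Qed.

(** Each end has distance M from the nearer edge vertex, where the tent is at most j+1. *)
Lemma tent_home j b b' : (j < M)%N -> tent j b (home b') = 0.
Proof.
move=> lt_jM; rewrite /tent val_home (_ : tent_nat _ _ _ = 0)%N //.
by rewrite /tent_nat; case: b; case: b' => /=; do ?case: ifP; lia.
Qed.

(** Raising j by one makes up for a change of the higher vertex. *)
Lemma tent_le j b b' u : tent j b u <= tent j.+1 b' u.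
Proof.
by rewrite /tent ler_nat /tent_nat; case: b; case: b' => /=; do ?case: ifP; lia.
Qed.

Lemma tent_lipschitz j b u : -1 <= tent j b u - tent j b (parent u) <= 1.
Proof.
rewrite /tent /= val_line_parent.
have [] : (tent_nat j b u <= (tent_nat j b u.-1).+1)%N /\
          (tent_nat j b u.-1 <= (tent_nat j b u).+1)%N.
  by rewrite /tent_nat; case: b => /=; do 2 case: ifP; lia.
rewrite -!(ler_nat R) -!natr1; lra.
Qed.

(** * The game against an online algorithm *)

Variable alg : online_algorithm k R.
Hypothesis alg_feasible : produces_feasible alg.

Let v0 := gathered false.
Let cost T rho := dual_objective v0 T rho (altitudes alg v0 rho).

Lemma alg_le rho s d T : size rho = T.*2 ->
  (forall u, alg v0 rho u <= alg v0 (rho ++ [:: s]) u) /\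
  (forall u, alg v0 (rho ++ [:: s]) u <= alg v0 (rho ++ [:: s; d]) u).
Proof.
move=> size_rho; have size_ext : size (rho ++ [:: s; d]) = T.+1.*2.
  by rewrite size_cat size_rho addn2.
have [_ mono] := alg_feasible v0 size_ext.
split=> u; rewrite -subr_ge0.
  have := mono u T.*2.+1; rewrite /altitudes doubleS ltnS leqnSn => /(_ isT).
  by rewrite !take_cat size_rho ltnn ltnNge leqnSn subnn subSnn /= cats0.
have := mono u T.*2.+2; rewrite /altitudes doubleS leqnn => /(_ isT).
by rewrite !take_cat size_rho !ltnNge ltnW // leqnSn subSnn -addn2 addKn.
Qed.

(** The altitudes after s are those of [rho ++ [:: s]], fixed before d is revealed, so the adversary
    may choose d by looking at them. *)
Lemma cost_cat rho s d T : size rho = T.*2 ->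
  let v := dc v0 rho T.*2 in
  let v' := dc_serve s v in
  cost T.+1 (rho ++ [:: s; d]) =
  cost T rho + serve_gain s v v' (alg v0 rho) (alg v0 (rho ++ [:: s]))
  - relocate_loss (dc_relocate s d v')
      (alg v0 (rho ++ [:: s])) (alg v0 (rho ++ [:: s; d])).
Proof.
move=> size_rho /=; rewrite /cost dual_objectiveS //.
have E0 : altitudes alg v0 (rho ++ [:: s; d]) ^~ T.*2 = alg v0 rho.
  by apply/funext => u; rewrite /altitudes -size_rho take_size_cat.
have E1 : altitudes alg v0 (rho ++ [:: s; d]) ^~ T.*2.+1 = alg v0 (rho ++ [:: s]).
  by apply/funext => u; rewrite /altitudes take_cat size_rho ltnNge leqnSn subSnn.
have E2 : altitudes alg v0 (rho ++ [:: s; d]) ^~ T.*2.+2 = alg v0 (rho ++ [:: s; d]).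
  by apply/funext => u; rewrite /altitudes take_oversize // size_cat size_rho addn2.
rewrite E0 E1 E2; congr (_ + _ - _).
rewrite -[X in dual_objective _ _ X _ = _]cats0.
apply: dual_objective_prefix; rewrite ?size_rho // => u t le_t.
by rewrite /altitudes takel_cat ?size_rho.
Qed.

(* The lower bound game after j rounds, with the active server i0 at [edge b]:
   A is an offline solution that has earned j. *)
Definition game_state j b T rho (A : G -> nat -> R) : Prop :=
  let v := dc v0 rho T.*2 in
  [/\ size rho = T.*2,
      [/\ dual_feasible T A, forall u, A u T.*2 = tent j b u &
          j%:R <= dual_objective v0 T rho A],
      cost T rho <= 1 /\
      cost T rho + (alg v0 rho (edge b) - alg v0 rho (edge (~~ b))) <= 1 &
      v i0 = edge b /\ forall i, i != i0 -> v i = home b \/ v i = home (~~ b)].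

Lemma game_state0 : exists A, game_state 0 false 0 [::] A.
Proof.
exists (fun u _ => tent 0 false u).
have obj0 A : dual_objective v0 0 [::] A = 0 :> R.
  by rewrite /dual_objective !big_geq ?subrr.
split=> //.
- split; rewrite ?obj0 //; split=> [u t _ _ _|u t _]; first exact: tent_lipschitz.
  by rewrite subrr.
- rewrite /cost obj0 add0r; split=> //.
  (* Any sequence of one round serves here: it puts time 0 before the horizon, and the slope bound
     across the middle edge gives the 1 in the potential bound. *)
  have [lip _] := @alg_feasible G v0 1 [:: edge false; edge false] erefl.
  have /(_ _ isT isT) := lip (edge true) 0.
  have -> : parent (edge true) = edge false.
    by apply: ord_inj; rewrite val_line_parent !val_edge addn1 addn0.
  have root_neq : edge true != tree_root.
    by apply/eqP => /(congr1 val); rewrite /= val_edge; lia.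
  by rewrite /altitudes take0 => /(_ root_neq); lra.
- by split=> [|i i_neq]; rewrite /= ffunE ?eqxx ?(negbTE i_neq); [|left].
Qed.

Lemma game_play j b T rho A : (j.+1 < M)%N ->
  game_state j b T rho A -> dc v0 rho T.*2 = gathered b ->
  exists s d b' A', game_state j.+1 b' T.+1 (rho ++ [:: s; d]) A'.
Proof.
move=> lt_jM [size_rho [feasA tentA objA] [cost_le pot_le] _] Ev.
pose s := edge (~~ b); pose h := alg v0 (rho ++ [:: s]).
have [b' le_h] : exists b', h (edge b') <= h (edge (~~ b')).
  by case: (leP (h (edge false)) (h (edge true))) => [?|/ltW ?];
    [exists false | exists true].
have [le_gh le_hf] := alg_le s (edge b') size_rho.
(* The offline solution takes the new tent, highest at the future d, already at the odd time; the
   relocation is then free. *)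
pose A' u t := if (t <= T.*2)%N then A u t else tent j.+1 b' u.
have A'0 u : A' u T.*2 = tent j b u.
  by rewrite /A' leqnn tentA.
have A'1 u : A' u T.*2.+1 = tent j.+1 b' u.
  by rewrite /A' ltnn.
have A'2 u : A' u T.*2.+2 = tent j.+1 b' u.
  by rewrite /A' ltnNge leqnSn.
exists s, (edge b'), b', A'.
have [_] := dc_cat2 v0 s (edge b') size_rho.
have := cost_cat s (edge b') size_rho.
cbv zeta; rewrite Ev serve_gathered -/s; set v' := finfun _.
have v'0 : v' i0 = s by rewrite ffunE eqxx.
have v'i i : i != i0 -> v' i = home b by rewrite ffunE => /negbTE ->.
have vi i : i != i0 -> gathered b i = home b by rewrite ffunE => /negbTE ->.
have gain A1 A2 := @serve_gain_move R _ _ s (gathered b) v' i0 A1 A2 v'0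
  (fun i i_neq => etrans (v'i i i_neq) (esym (vi i i_neq))).
rewrite (dc_relocate_unique _ v'0) => [|i /v'i ->]; last exact: home_neq_edge.
set v'' := finfun _.
have v''0 : v'' i0 = edge b' by rewrite ffunE eqxx.
rewrite gain ffunE eqxx => cost_step E2.
split=> //.
- by rewrite size_cat size_rho addn2.
- split.
  + apply: feasible_extend => // u; rewrite ?tentA.
      exact: tent_lipschitz.
    exact: tent_le.
  + by move=> u; rewrite doubleS A'2.
  rewrite dual_objectiveS // Ev serve_gathered -/s -/v' gain ffunE eqxx !A'0.
  rewrite /relocate_loss big1 => [|i i_neq]; last first.
    by rewrite vi // A'0 A'1 !tent_home ?subrr // ltnW.
  rewrite big1 => [|i _]; last by rewrite A'1 A'2 subrr.
  have -> : dual_objective v0 T rho A' = dual_objective v0 T rho A.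
    rewrite -[X in dual_objective _ _ X _ = _]cats0.
    by apply: dual_objective_prefix; rewrite ?size_rho // => u t le_t; rewrite /A' le_t.
  (* The old tent is one higher at [edge b] than at s: this difference is the gain of the round. *)
  by rewrite /s !tent_edge eqxx; case: (b) objA;
    rewrite /= -natr1 ?addn0 ?addn1 -natr1; lra.
(* Let g, h, f be the online altitudes before the round, after s and after d = [edge b']. The cost
   grows by at most g([edge b]) - g(s), which the old potential already counts, minus f(d) - h(d).
   So the new potential exceeds the old one by at most h(d) - f([edge (~~ b')]), which is at most 0
   by the choice of [b'] and h <= f. *)
- have := relocate_loss_ge v'' i0 le_hf; rewrite v''0 => loss.
  have others_ge0 :
      0 <= \sum_(i < k | i != i0) (h (gathered b i) - alg v0 rho (gathered b i)).
    by apply: sumr_ge0 => i _; rewrite subr_ge0.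
  have loss_ge0 := le_hf (edge b').
  by rewrite /h in le_h others_ge0 *; split; move: (le_hf (edge (~~ b'))); lra.
- rewrite doubleS E2; split=> // i i_neq.
  rewrite ffunE (negbTE i_neq) v'i //.
  by case: (b) (b') => -[]; [left|right|right|left].
Qed.

(** A request where a server already stands moves nobody, and its relocation brings one server to
    [home b]. That server [i1] may differ from [i], as DC picks among co-located ones. The offline
    altitudes stay constant. *)
Lemma game_gather1 j b T rho A i : (j < M)%N ->
  game_state j b T rho A -> dc v0 rho T.*2 i = home (~~ b) ->
  exists i1, dc v0 rho T.*2 i1 = home (~~ b) /\
  exists s d A', game_state j b T.+1 (rho ++ [:: s; d]) A' /\
    dc v0 (rho ++ [:: s; d]) T.+1.*2 =
      [ffun i' => if i' == i1 then home b else dc v0 rho T.*2 i'].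
Proof.
move=> lt_jM [size_rho [feasA tentA objA] [cost_le pot_le] [v0b vi]] v_i.
pose s := home (~~ b); pose h := alg v0 (rho ++ [:: s]).
have [i1 v_i1 relocate] := dc_relocate_some (home b) v_i.
exists i1; split=> //.
have [le_gh le_hf] := alg_le s (home b) size_rho.
pose A' u t := if (t <= T.*2)%N then A u t else tent j b u.
have A'0 u : A' u T.*2 = tent j b u.
  by rewrite /A' leqnn tentA.
have A'1 u : A' u T.*2.+1 = tent j b u.
  by rewrite /A' ltnn.
have A'2 u : A' u T.*2.+2 = tent j b u.
  by rewrite /A' ltnNge leqnSn.
exists s, (home b), A'.
have [_] := dc_cat2 v0 s (home b) size_rho.
have := cost_cat s (home b) size_rho.
cbv zeta; rewrite (dc_serve_id v_i) relocate.
have gain A1 A2 := @serve_gain_move R _ _ s (dc v0 rho T.*2) _ i A1 A2 v_i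
  (fun i' _ => erefl).
rewrite gain v_i subrr sub0r.
set v := dc v0 rho T.*2 in v0b vi v_i v_i1 relocate gain *.
have neq_i0 i' : v i' = s -> i0 != i'.
  by move=> v_i'; apply/eqP => eq_i'; have := home_neq_edge (~~ b) b;
    rewrite -v0b eq_i' -/s v_i' eqxx.
set v'' := finfun _ => cost_step E2.
have v''0 : v'' i0 = edge b by rewrite ffunE (negbTE (neq_i0 _ v_i1)).
split; last by rewrite doubleS.
split.
- by rewrite size_cat size_rho addn2.
- split.
  + apply: feasible_extend => // u; rewrite ?tentA //; exact: tent_lipschitz.
  + by move=> u; rewrite doubleS A'2.
  rewrite dual_objectiveS // (dc_serve_id v_i) relocate gain v_i subrr sub0r.
  rewrite /relocate_loss big1 => [|i' _]; last by rewrite A'0 A'1 subrr.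
  rewrite big1 => [|i' _]; last by rewrite A'1 A'2 subrr.
  rewrite !(subr0, oppr0, addr0).
  suff -> : dual_objective v0 T rho A' = dual_objective v0 T rho A by [].
  rewrite -[X in dual_objective _ _ X _ = _]cats0.
  by apply: dual_objective_prefix; rewrite ?size_rho // => u t le_t; rewrite /A' le_t.
(* The resting server [i0] pays for every rise of the altitude at [edge b], which offsets that rise
   in the potential. *)
- have := relocate_loss_ge v'' i0 le_hf; rewrite v''0 => loss.
  move: cost_step; rewrite (bigD1 i0) ?neq_i0 //= v0b => cost_step.
  have : 0 <= \sum_(i' < k | (i' != i) && (i' != i0)) (h (v i') - alg v0 rho (v i')).
    by apply: sumr_ge0 => i' _; rewrite subr_ge0.
  move: cost_step loss (le_gh (edge b)) (le_hf (edge b))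
    (le_gh (edge (~~ b))) (le_hf (edge (~~ b))).
  by rewrite -/h; split; lra.
- rewrite doubleS E2; split=> // i' i'_neq; rewrite ffunE.
  by case: eqP => _; [left | apply: vi].
Qed.

Definition strays b (v : configuration G k) := [set i | v i == home (~~ b)].

(** Induction on the number of strays: each gathering round removes one and creates none. *)
Lemma game_gather j b T rho A : (j < M)%N -> game_state j b T rho A ->
  exists T' rho' A', game_state j b T' rho' A' /\ dc v0 rho' T'.*2 = gathered b.
Proof.
move=> lt_jM; have [m] := ubnP #|strays b (dc v0 rho T.*2)|.
elim: m T rho A => // m IHm T rho A le_m state.
have [strays0|[i]] := set_0Vmem (strays b (dc v0 rho T.*2)).
  exists T, rho, A; split=> //; apply/ffunP => i; rewrite ffunE.
  have [_ _ _ [v0b vi]] := state; case: eqP => [->//|/eqP/vi[//|v_i]].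
  by move/setP/(_ i): strays0; rewrite !inE v_i eqxx.
rewrite inE => /eqP /(game_gather1 lt_jM state) [i1 [v_i1 [s [d [A' [state' Ev]]]]]].
apply: IHm state'; rewrite -ltnS; apply: leq_trans le_m.
rewrite ltnS; apply: proper_card; apply/properP; split.
  apply/fintype.subsetP => i'; rewrite !inE Ev ffunE; have [_|//] := eqVneq i' i1.
  by rewrite (negbTE (home_neq b)).
by exists i1; rewrite inE ?v_i1 ?eqxx // Ev ffunE eqxx (negbTE (home_neq b)).
Qed.

Lemma game_result j : (j < M)%N ->
  exists b T rho A, game_state j b T rho A /\ dc v0 rho T.*2 = gathered b.
Proof.
elim: j => [|j IHj] lt_jM.
  have [A state] := game_state0; have [T [rho [A' ?]]] := game_gather lt_jM state.
  by exists false, T, rho, A'.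
have [b [T [rho [A [state Ev]]]]] := IHj (ltnW lt_jM).
have [s [d [b' [A' state']]]] := game_play lt_jM state Ev.
have [T' [rho' [A'' ?]]] := game_gather lt_jM state'.
by exists b', T', rho', A''.
Qed.

Lemma dual_opt_gap N : (N < M)%N ->
  exists T rho, [/\ size rho = T.*2, cost T rho <= 1 &
    (N%:R%:E <= dual_opt R v0 T rho)%E].
Proof.
move=> /game_result [b [T [rho [A [[size_rho [feasA _ objA] [cost_le _] _] _]]]]].
exists T, rho; split=> //; apply: le_trans (ereal_sup_ubound _); last by exists A.
by rewrite lee_fin.
Qed.

End Adversary.

Theorem theorem4 (R : realType) (k : nat) (hk : (1 <= k)%N) :
  ~ exists alg : online_algorithm k R,
      produces_feasible alg /\ competitive alg.
Proof.
move=> [alg [feas [c [a [c_gt0 compet]]]]].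
(* With this N, the guarantee N/c - a exceeds 1, the bound on the online objective. *)
have [N lt_N] : exists N : nat, c * (a + 1) < N%:R.
  by exists (Num.truncn (c * (a + 1))).+1; rewrite truncnS_gt.
have [T [rho [size_rho cost_le opt_ge]]] :=
  dual_opt_gap (Ordinal hk) (ltn0Sn N) feas (ltnSn N).
have := compet _ (gathered N.+1 (Ordinal hk) false) T rho size_rho.
apply/negP; rewrite -ltNge; apply: le_lt_trans (_ : _ <= 1%:E)%E _.
  by rewrite lee_fin.
have : (c^-1%:E * N%:R%:E <=
    c^-1%:E * dual_opt R (gathered N.+1 (Ordinal hk) false) T rho)%E.
  by rewrite lee_wpmul2l // lee_fin invr_ge0 ltW.
move/(leeD2r (- a%:E)%E); apply: lt_le_trans.
by rewrite -EFinM -EFinB lte_fin ltrBrDr mulrC ltr_pdivlMr // mulrC addrC.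
Qed.
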